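(* Let $A$ be a finite abelian group, $\chi$ a non-degenerate symmetric bicharacter of $A$, and $\tau$ a square root of $|A|^{-1}$. Let $m$ be the non-invertible simple object of $\mathcal{TY}(A,\chi,\tau)$, equipped with its canonical pivotal structure. Suppose that $n=2k$ is an even positive integer. Then $$\nu_n(m)=\frac{\mathrm{sgn}(\tau)^k}{|A|^{\frac12(k-1)}}\sum_{a_1\cdots a_k=1}\ \prod_{1\le i<j\le k}\chi(a_i,a_j),$$ where the sum runs through all $(a_1,\dots,a_k)\in A^k$ such that $a_1\cdots a_k=1$.
   Context: Everything is over $\mathbb{C}$; groups are written multiplicatively. A bicharacter of $A$ is a map $\chi: A\times A\to\mathbb{C}^\times$ multiplicative in each variable; it is symmetric if $\chi(a,b)=\chi(b,a)$, and non-degenerate if $\chi(x,a)=1$ for all $x\in A$ implies $a=1$. Tambara-Yamagami category. $\mathcal{TY}(A,\chi,\tau)$ (with $\tau\in\mathbb{R}$, $\tau^2=|A|^{-1}$) is the skeletal $\mathbb{C}$-linear monoidal category whose objects are finite direct sums of elements of $S=A\sqcup\{m\}$, with $\mathrm{Hom}(s,s')=\mathbb{C}$ if $s=s'$ and $0$ otherwise ($s,s'\in S$) and the obvious composition. The tensor product is $a\otimes b=ab$, $a\otimes m=m=m\otimes a$, $m\otimes m=\bigoplus_{x\in A}x$ ($a,b\in A$). The unit object is $1\in A$ with identity unit constraints. The associativity constraint $\Phi_{X,Y,Z}:(X\otimes Y)\otimes Z\to X\otimes(Y\otimes Z)$ is determined by $\Phi_{a,m,b}=\chi(a,b)\,\mathrm{id}_m$,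 $\Phi_{m,a,m}=(\chi(a,x)\delta_{x,y}\mathrm{id}_x)_{x,y}:\bigoplus_x x\to\bigoplus_y y$, $\Phi_{m,m,m}=(\tau\chi(x,y)^{-1}\mathrm{id}_m)_{x,y}:\bigoplus_{x\in A}m\to\bigoplus_{y\in A}m$, all other $\Phi_{s,t,u}$ ($s,t,u\in S$) being identities. The left dual of $a\in A$ is $a^{-1}$ with identity coevaluation and evaluation; the left dual of $m$ is $m$ with coevaluation the injection $1\to m\otimes m$ and evaluation $\tau^{-1}p$, where $p:m\otimes m\to1$ is the projection. The bidual functor is the identity, and the canonical pivotal structure is $j_a=\mathrm{id}_a$ ($a\in A$), $j_m=\mathrm{sgn}(\tau)\,\mathrm{id}_m$. Frobenius-Schur indicators. Let $\mathcal{C}$ be a $\mathbb{C}$-linear rigid monoidal category with pivotal structure $j:\mathrm{id}\to(-)^{**}$, coevaluations $d_V:1\to V\otimes V^*$ and evaluations $b_V:V^*\otimes V\to 1$. Put $V^{\otimes0}=1$, $V^{\otimes 1}=V$, $V^{\otimes n}=V\otimes V^{\otimes(n-1)}$ for $n\ge2$. Let $A^X_{Y,Z}:\mathrm{Hom}(X,Y\otimes Z)\to\mathrm{Hom}(Y^*\otimes X,Z)$ and $B^{X,Y}_Z:\mathrm{Hom}(X\otimes Y,Z)\to\mathrm{Hom}(X,Z\otimes Y^* )$ be the standard duality isomorphisms (up to associativity, $f\mapsto(b_Y\otimes\mathrm{id}_Z)(\mathrm{id}_{Y^*}\otimes f)$ and $g\mapsto(g\otimes\mathrm{id}_{Y^*})(\mathrm{id}_X\otimes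 d_Y)$). Define the linear automorphism $E_V^{(n)}$ of $\mathrm{Hom}(1,V^{\otimes n})$ by $E_V^{(n)}(f)=\Phi\circ(\mathrm{id}_{V^{\otimes(n-1)}}\otimes j_V^{-1})\circ B^{1,V^*}_{V^{\otimes(n-1)}}(A^1_{V,V^{\otimes(n-1)}}(f))$, where $\Phi:V^{\otimes(n-1)}\otimes V\to V^{\otimes n}$ is the associativity isomorphism. The $n$-th Frobenius-Schur indicator is $\nu_n(V)=\mathrm{Tr}(E_V^{(n)})$. *)

(* Defs.v *)
From HB Require Import structures.
From mathcomp Require Import all_boot all_order all_fingroup all_algebra.
From mathcomp Require Import complex.
From mathcomp Require Import classical_sets reals.

Set Implicit Arguments.
Unset Strict Implicit.
Unset Printing Implicit Defensive.

Import GRing.Theory Num.Theory.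
Local Open Scope ring_scope.

(* The trace of a linear endomorphism, computed in the standard basis chosen by
   the library (the trace does not depend on the basis). *)
Definition lftrace (K : fieldType) (V : vectType K) (f : 'End(V)) : K :=
  \tr (passmx.mxof (vbasis {:V}) (vbasis {:V}) f).

(* The data of a K-linear left rigid monoidal category with a pivotal structure.
   Apart from bilinearity, which makes the map E_V^{(n)} linear, only data are
   recorded: the other axioms play no role in the definition of the indicators,
   which are therefore defined for arbitrary such data.
   [pcomp g f] is the composite "g after f"; duals are left duals. *)
Record pivotalData (K : fieldType) := PivotalData {
  pobj   : Type;
  phom   : pobj -> pobj -> vectType K;
  pid    : forall X, phom X X;
  pcomp  : forall X Y Z, phom Y Z -> phom X Y -> phom X Z;
  punit  : pobj;
  ptens  : pobj -> pobj -> pobj;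
  ptensh : forall X X' Y Y',
    phom X X' -> phom Y Y' -> phom (ptens X Y) (ptens X' Y');
  plunit : forall X, phom (ptens punit X) X;
  prunit : forall X, phom (ptens X punit) X;
  passoc : forall X Y Z, phom (ptens (ptens X Y) Z) (ptens X (ptens Y Z));
  pdual  : pobj -> pobj;
  pcoev  : forall X, phom punit (ptens X (pdual X));
  pev    : forall X, phom (ptens (pdual X) X) punit;
  ppiv   : forall X, phom X (pdual (pdual X));
  pcomp_linearl  : forall X Y Z (f : phom X Y),
    linear (fun g : phom Y Z => pcomp g f);
  pcomp_linearr  : forall X Y Z (g : phom Y Z),
    linear (fun f : phom X Y => pcomp g f);
  ptensh_linearl : forall X X' Y Y' (g : phom Y Y'),
    linear (fun f : phom X X' => ptensh f g);
  ptensh_linearr : forall X X' Y Y' (f : phom X X'),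
    linear (fun g : phom Y Y' => ptensh f g)
}.

Arguments pid {K p} X.
Arguments punit {K p}.
Arguments plunit {K p} X.
Arguments prunit {K p} X.
Arguments passoc {K p} X Y Z.
Arguments pcoev {K p} X.
Arguments pev {K p} X.
Arguments ppiv {K p} X.

Section Indicators.
Variables (K : fieldType) (C : pivotalData K).

Local Notation obj := (pobj C).
Local Notation "X --> Y" := (phom X Y) (at level 99, Y at level 200).
Local Notation "g ⊚ f" := (pcomp g f) (at level 50, left associativity).
Local Notation "X ⊗ Y" := (ptens X Y) (at level 40, left associativity).
Local Notation "f ⊠ g" := (ptensh f g) (at level 40, left associativity).
Local Notation "X ^v" := (pdual X) (at level 2, format "X ^v").

(* The inverse of f, with the junk value 0 if f is not an isomorphism. *)
Definition pinv (X Y : obj) (f : X --> Y) : Y --> X :=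
  xget 0 [set g : phom Y X | g ⊚ f = pid X /\ f ⊚ g = pid Y]%classic.

Fixpoint tpow (V : obj) (n : nat) : obj :=
  match n with
  | 0 => punit
  | p.+1 => match p with 0 => V | _.+1 => V ⊗ tpow V p end
  end.

(* A^X_{Y,Z} : Hom(X, Y ⊗ Z) -> Hom(Y^* ⊗ X, Z) *)
Definition dualA (X Y Z : obj) (f : X --> Y ⊗ Z) : Y^v ⊗ X --> Z :=
  plunit Z ⊚ (pev Y ⊠ pid Z) ⊚ pinv (passoc Y^v Y Z) ⊚ (pid Y^v ⊠ f).

(* B^{X,Y}_Z : Hom(X ⊗ Y, Z) -> Hom(X, Z ⊗ Y^* ) *)
Definition dualB (X Y Z : obj) (g : X ⊗ Y --> Z) : X --> Z ⊗ Y^v :=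
  (g ⊠ pid Y^v) ⊚ pinv (passoc X Y Y^v) ⊚ (pid X ⊠ pcoev Y)
    ⊚ pinv (prunit X).

(* The canonical identification of V^{⊗(p+1)} with V ⊗ V^{⊗p}; the two objects
   are equal by definition unless p = 0. *)
Definition tpow_split (V : obj) (p : nat) : tpow V p.+1 --> V ⊗ tpow V p :=
  match p with 0 => pinv (prunit V) | _.+1 => pid _ end.

(* The associativity isomorphism V^{⊗p} ⊗ V -> V^{⊗(p+1)}. *)
Fixpoint tpow_assoc (V : obj) (p : nat) : tpow V p ⊗ V --> tpow V p.+1 :=
  match p return tpow V p ⊗ V --> tpow V p.+1 with
  | 0 => plunit V
  | q.+1 =>
    match q return (tpow V q ⊗ V --> tpow V q.+1) ->
                   (tpow V q.+1 ⊗ V --> tpow V q.+2) with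
    | 0 => fun=> pid _
    | r.+1 => fun IHq => (pid V ⊠ IHq) ⊚ passoc V (tpow V r.+1) V
    end (tpow_assoc V q)
  end.

(* E_V^{(n)} for n = p + 1. The unit constraints identify V^* ⊗ 1, the domain of
   A^1(f), with 1 ⊗ V^*, the domain required by B^{1,V^*}. *)
Definition FSrot (V : obj) (p : nat) (f : punit --> tpow V p.+1) :
    punit --> tpow V p.+1 :=
  tpow_assoc V p ⊚ (pid (tpow V p) ⊠ pinv (ppiv V))
    ⊚ dualB (dualA (tpow_split V p ⊚ f)
                ⊚ pinv (prunit V^v) ⊚ plunit V^v).

Lemma FSrot_linear V p : linear (@FSrot V p).
Proof.
move=> a f g; rewrite /FSrot /dualB /dualA.
by rewrite !(pcomp_linearr, pcomp_linearl, ptensh_linearr, ptensh_linearl).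
Qed.

(* nu_n(V); it is only meaningful for n > 0. *)
Definition FSind (V : obj) (n : nat) : K :=
  if n is p.+1 then lftrace (linfun (@FSrot V p)) else 0.

End Indicators.

Section Bicharacters.
Variables (gT : finGroupType) (K : fieldType).

Definition bicharacter (chi : gT -> gT -> K) : Prop :=
  [/\ forall a b, chi a b != 0,
      forall a b c, chi (a * b)%g c = chi a c * chi b c
    & forall a b c, chi a (b * c)%g = chi a b * chi a c].

Definition symmetric_bichar (chi : gT -> gT -> K) : Prop :=
  forall a b, chi a b = chi b a.

Definition nondegenerate_bichar (chi : gT -> gT -> K) : Prop :=
  forall a, (forall x, chi x a = 1) -> a = 1%g.

End Bicharacters.

Section TambaraYamagami.
Variables (R : realType) (gT : finGroupType).
Variables (chi : gT -> gT -> R[i]) (tau : R).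

Local Notation C := (R[i]).
Local Open Scope complex_scope.

(* S = A ⊔ {m}: [Some a] is the invertible object a and [None] is m. *)
Definition TYsimple : finType := option gT.

(* [TYfus s t u] iff u is a summand of s ⊗ t; all multiplicities are at most 1. *)
Definition TYfus (s t u : TYsimple) : bool :=
  match s, t, u with
  | Some a, Some b, Some c => c == (a * b)%g
  | Some _, None, None => true
  | None, Some _, None => true
  | None, None, Some _ => true
  | _, _, _ => false
  end.

(* A finite direct sum of elements of S is a finite family of elements of S. *)
Record TYobj := TYObj { TYidx : finType; TYlab : TYidx -> TYsimple }.

Definition TYsimp (s : TYsimple) : TYobj := @TYObj unit (fun=> s).

(* A morphism X -> Y is a matrix with one scalar for each pair of equal simple
   summands (of Y and of X), the other entries being zero. *)
Definition TYhom (X Y : TYobj) : vectType C :=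
  {ffun {p : TYidx Y * TYidx X | TYlab p.1 == TYlab p.2} -> C^o}.

Definition TYmk (X Y : TYobj) (e : TYidx Y -> TYidx X -> C) : TYhom X Y :=
  [ffun p => e (val p).1 (val p).2].

Definition TYent (X Y : TYobj) (f : TYhom X Y) (j : TYidx Y) (i : TYidx X) : C :=
  if insub (j, i) is Some p then f p else 0.

Definition TYid (X : TYobj) : TYhom X X := TYmk (fun j i => (j == i)%:R).

Definition TYcomp (X Y Z : TYobj) (g : TYhom Y Z) (f : TYhom X Y) : TYhom X Z :=
  TYmk (fun k i => \sum_(j : TYidx Y) TYent g k j * TYent f j i).

(* The summands of X ⊗ Y are indexed by the triples (i, j, u) such that u is a
   summand of X_i ⊗ Y_j. *)
Definition TYtens (X Y : TYobj) : TYobj :=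
  @TYObj {q : TYidx X * TYidx Y * TYsimple |
            TYfus (TYlab q.1.1) (TYlab q.1.2) q.2}
         (fun q => (val q).2).

Definition TYtensh (X X' Y Y' : TYobj) (f : TYhom X X') (g : TYhom Y Y') :
    TYhom (TYtens X Y) (TYtens X' Y') :=
  TYmk (fun (q : TYidx (TYtens X' Y')) (p : TYidx (TYtens X Y)) =>
    ((val q).2 == (val p).2)%:R *
    TYent f (val q).1.1 (val p).1.1 * TYent g (val q).1.2 (val p).1.2).

Definition TYunit : TYobj := TYsimp (Some 1%g).

Definition TYlunit (X : TYobj) : TYhom (TYtens TYunit X) X :=
  TYmk (fun i (p : TYidx (TYtens TYunit X)) => (i == (val p).1.2)%:R).

Definition TYrunit (X : TYobj) : TYhom (TYtens X TYunit) X :=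
  TYmk (fun i (p : TYidx (TYtens X TYunit)) => (i == (val p).1.1)%:R).

(* The entry of Phi_{s,t,r} from the summand v of u ⊗ r, where u is a summand of
   s ⊗ t, to the summand v of s ⊗ w, where w is a summand of t ⊗ r. *)
Definition TYassoc_coef (s t r v u w : TYsimple) : C :=
  match s, t, r with
  | Some a, None, Some b => chi a b
  | None, Some a, None => if v is Some x then chi a x else 0
  | None, None, None =>
      match u, w with
      | Some x, Some y => tau%:C * (chi x y)^-1
      | _, _ => 0
      end
  | _, _, _ => 1
  end.

Definition TYassoc (X Y Z : TYobj) :
    TYhom (TYtens (TYtens X Y) Z) (TYtens X (TYtens Y Z)) :=
  TYmk (fun (q : TYidx (TYtens X (TYtens Y Z)))
            (p : TYidx (TYtens (TYtens X Y) Z)) =>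
    let: ((xy, k), v) := val p in
    let: ((i, j), u) := val xy in
    let: ((i', yz), v') := val q in
    let: ((j', k'), w) := val yz in
    [&& i' == i, j' == j, k' == k & v' == v]%:R *
    TYassoc_coef (TYlab i) (TYlab j) (TYlab k) v u w).

Definition TYdual (X : TYobj) : TYobj :=
  @TYObj (TYidx X) (fun i => omap (fun a => a^-1)%g (TYlab i)).

Definition TYcoev (X : TYobj) : TYhom TYunit (TYtens X (TYdual X)) :=
  TYmk (fun (p : TYidx (TYtens X (TYdual X))) _ =>
    ((val p).1.1 == (val p).1.2)%:R).

Definition TYev (X : TYobj) : TYhom (TYtens (TYdual X) X) TYunit :=
  TYmk (fun _ (p : TYidx (TYtens (TYdual X) X)) =>
    ((val p).1.1 == (val p).1.2)%:R *
    (if TYlab (val p).1.2 is None then (tau%:C)^-1 else 1)).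

Definition TYpiv (X : TYobj) : TYhom X (TYdual (TYdual X)) :=
  TYmk (fun (j : TYidx (TYdual (TYdual X))) (i : TYidx X) =>
    (j == i :> TYidx X)%:R *
    (if TYlab i is None then (Num.sg tau)%:C else 1)).

Lemma TYent_linear X Y j i : linear (fun f : TYhom X Y => TYent f j i : C^o).
Proof.
move=> a f g; rewrite /TYent; case: insubP => [p _ _|_]; first by rewrite !ffunE.
by rewrite scaler0 addr0.
Qed.

Lemma TYcomp_linearl X Y Z (f : TYhom X Y) :
  linear (fun g : TYhom Y Z => TYcomp g f).
Proof.
move=> a g h; apply/ffunP => p; rewrite !ffunE.
rewrite -[RHS]/(a * _ + _) mulr_sumr -big_split; apply: eq_bigr => j _ /=.
by rewrite TYent_linear mulrDl -[a *: _]/(a * _) -mulrA.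
Qed.

Lemma TYcomp_linearr X Y Z (g : TYhom Y Z) :
  linear (fun f : TYhom X Y => TYcomp g f).
Proof.
move=> a f h; apply/ffunP => p; rewrite !ffunE.
rewrite -[RHS]/(a * _ + _) mulr_sumr -big_split; apply: eq_bigr => j _ /=.
by rewrite TYent_linear mulrDr -[a *: _]/(a * _) mulrCA.
Qed.

Lemma TYtensh_linearl X X' Y Y' (g : TYhom Y Y') :
  linear (fun f : TYhom X X' => TYtensh f g).
Proof.
move=> a f h; apply/ffunP => p; rewrite !ffunE TYent_linear.
rewrite -[RHS]/(a * _ + _) mulrDr mulrDl; congr (_ + _).
by rewrite -[a *: _]/(a * _) mulrCA !mulrA.
Qed.

Lemma TYtensh_linearr X X' Y Y' (f : TYhom X X') :
  linear (fun g : TYhom Y Y' => TYtensh f g).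
Proof.
move=> a g h; apply/ffunP => p; rewrite !ffunE TYent_linear.
by rewrite -[RHS]/(a * _ + _) mulrDr -[a *: _]/(a * _) mulrCA.
Qed.

Definition TY : pivotalData C :=
  @PivotalData C TYobj TYhom TYid TYcomp TYunit TYtens TYtensh
    TYlunit TYrunit TYassoc TYdual TYcoev TYev TYpiv
    TYcomp_linearl TYcomp_linearr TYtensh_linearl TYtensh_linearr.

Definition TYm : pobj TY := TYsimp None.

End TambaraYamagami.

(* Main.v *)
Require Import Defs.
From HB Require Import structures.
From mathcomp Require Import all_boot all_order all_fingroup all_algebra.
From mathcomp Require Import complex.
From mathcomp Require Import reals.
From mathcomp Require Import classical_sets.

Set Implicit Arguments.
Unset Strict Implicit.
Unset Printing Implicit Defensive.

Import GRing.Theory Num.Theory.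
Local Open Scope ring_scope.
Local Open Scope complex_scope.

(** Write [m^n] for the right-bracketed tensor power. The summands of [m^(2k)]
    are indexed by tuples [(x_1, ..., x_k)] in [A^k]: [x_i] is the summand
    chosen in the [2i]-th power, counting from the innermost factors, and the
    odd powers only contain [m]. Those equal to the unit have [x_k = 1] and give
    a basis of Hom(1, [m^(2k)]), in which the trace of [E_m^(2k)] is computed.

    The duality isomorphisms turn the column of [x] into the matching column of
    the associativity isomorphism [m^(2k-1) * m -> m^(2k)]: the entry [tau] of
    the inverse associator cancels the factor [tau^-1] of the evaluation
    ([TYent_dualA]), the coevaluation has coefficient 1 ([TYent_dualB]), and the
    pivotal structure contributes the sign of [tau] ([FSrot_diag]). Inverting
    the associator of [m], [m] and an odd power of [m] is where non-degeneracy
    is used, through the orthogonality of characters ([bichar_ortho],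
    [pinv_assoc_mm]).

    The associativity isomorphism [m^p * m -> m^(p+1)] is a composite of
    associators of the form [(m, x, m)] and [(m, m, m)] in alternation. On the
    diagonal, its entries are products of factors
    [tau * chi (x_i, x_(i+1)) / chi (x_i, x_i)], so that the sums [S_k(v)] of
    its diagonal entries over the tuples with [x_k = v] satisfy
    [S_(k+1)(v) = tau * sum_x chi (x, v) / chi (x, x) * S_k(x)]
    ([assoc_specS]). Up to the factor [tau], the same recursion governs the sums
    of [prod_(i < j) chi (a_i, a_j)] over the tuples with product [v], where [x]
    is the product of all entries but the last ([bichar_tuple_sumS]): the
    substitution behind the theorem is [x_i = a_1 ... a_i]. Hence the indicator
    is [sgn tau * tau^(k-1)] times the required sum. *)

(** * Traces on spaces of functions *)

Lemma linfunE_linear (K : fieldType) (U V : vectType K) (g : U -> V) :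
  linear g -> linfun g =1 g.
Proof.
move=> g_lin u.
pose gL : {linear U -> V} :=
  HB.pack g (GRing.isLinear.Build K U V *:%R g g_lin).
exact: (lfunE gL).
Qed.

Lemma lftrace_coord (K : fieldType) (V : vectType K) (f : 'End(V)) :
  lftrace f = \sum_i coord (vbasis {:V}) i (f (vbasis {:V})`_i).
Proof.
rewrite /lftrace /mxtrace; apply: eq_bigr => i _.
by rewrite !mxE /= passmx.vecof_delta passmx.coord_rVof.
Qed.

(** On a space of scalar functions, the trace can be read off on the indicator
    functions of points. *)
Lemma lftrace_ffun (K : fieldType) (I : finType) (f : 'End({ffun I -> K^o})) :
  lftrace f = \sum_p f [ffun q => (q == p)%:R] p.
Proof.
rewrite lftrace_coord; set b := vbasis _.
have fE v : f v = \sum_p v p *: f [ffun q => (q == p)%:R].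
  have {1}-> : v = \sum_p v p *: [ffun q => (q == p)%:R].
    apply/ffunP => q; rewrite sum_ffunE (bigD1 q) //= big1 => [|p].
      by rewrite addr0 !ffunE eqxx /GRing.scale /= mulr1.
    by rewrite !ffunE eq_sym => /negPf ->; rewrite scaler0.
  by rewrite linear_sum; apply: eq_bigr => p _; rewrite linearZ.
under eq_bigr => i _ do rewrite fE linear_sum.
rewrite exchange_big /=; apply: eq_bigr => p _.
rewrite {2}[f _](coord_vbasis (memvf _)) sum_ffunE.
by apply: eq_bigr => i _; rewrite linearZ /= !ffunE mulrC.
Qed.

(** * Morphisms as matrices *)

Section MatrixCalculus.
Variables (R : realType) (gT : finGroupType).
Variables (chi : gT -> gT -> R[i]) (tau : R).
Implicit Types X Y Z W : TYobj gT.
Local Notation hom := (@TYhom R gT).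
Local Notation TY := (TY chi tau).

Lemma TYent_mk X Y (e : TYidx Y -> TYidx X -> R[i]) j i :
  TYent (TYmk e) j i = if TYlab j == TYlab i then e j i else 0.
Proof.
rewrite /TYent; case: insubP => [p eq_ji pE|/negPf /= -> //].
by rewrite ffunE pE /=; move: eq_ji => /= ->.
Qed.

Lemma TYent_neq X Y (f : hom X Y) j i : TYlab j != TYlab i -> TYent f j i = 0.
Proof. by rewrite /TYent => /= ne; rewrite insubN. Qed.

Lemma TYent_val X Y (f : hom X Y) p : f p = TYent f (val p).1 (val p).2.
Proof. by rewrite /TYent -surjective_pairing valK. Qed.

Lemma TYhom_ext X Y (f g : hom X Y) :
  (forall j i, TYent f j i = TYent g j i) -> f = g.
Proof. by move=> eq_fg; apply/ffunP => p; rewrite !TYent_val eq_fg. Qed.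

Lemma TYent_id X j i : TYent (TYid R X) j i = (j == i)%:R.
Proof.
rewrite TYent_mk; case: eqP => // ne; case: (eqVneq j i) => // eq_ji.
by case: ne; rewrite eq_ji.
Qed.

Lemma TYent_comp X Y Z (g : hom Y Z) (f : hom X Y) k i :
  TYent (TYcomp g f) k i = \sum_j TYent g k j * TYent f j i.
Proof.
rewrite TYent_mk; case: eqP => // ne; rewrite big1 // => j _.
have [kj|/TYent_neq->] := eqVneq (TYlab k) (TYlab j); last by rewrite mul0r.
by rewrite [X in _ * X]TYent_neq ?mulr0 // -kj; apply/eqP.
Qed.

Lemma TYent_tensh X X' Y Y' (f : hom X X') (g : hom Y Y') q p :
  TYent (TYtensh f g) q p =
  ((val q).2 == (val p).2)%:R *
    TYent f (val q).1.1 (val p).1.1 * TYent g (val q).1.2 (val p).1.2.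
Proof. by rewrite TYent_mk /=; case: eqP; rewrite ?mul0r. Qed.

Lemma TYcompA X Y Z W (h : hom Z W) (g : hom Y Z) (f : hom X Y) :
  TYcomp h (TYcomp g f) = TYcomp (TYcomp h g) f.
Proof.
apply: TYhom_ext => l i; rewrite !TYent_comp.
under eq_bigr => k _ do rewrite TYent_comp mulr_sumr.
rewrite exchange_big /=; apply: eq_bigr => j _.
by rewrite TYent_comp mulr_suml; apply: eq_bigr => k _; rewrite mulrA.
Qed.

(** The next two lemmas compose with a morphism each column, respectively each
    row, of which has a single nonzero entry. *)
Lemma TYent_compr X Y Z (g : hom Y Z) (f : hom X Y) k i i' c :
  (forall j, TYent f j i = (j == i')%:R * c) ->
  TYent (TYcomp g f) k i = TYent g k i' * c.
Proof.
move=> fE; rewrite TYent_comp (bigD1 i') //= fE eqxx mul1r big1 ?addr0 // => j.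
by rewrite fE => /negPf->; rewrite mul0r mulr0.
Qed.

Lemma TYent_compl X Y Z (g : hom Y Z) (f : hom X Y) k k' i c :
  (forall j, TYent g k j = (j == k')%:R * c) ->
  TYent (TYcomp g f) k i = c * TYent f k' i.
Proof.
move=> gE; rewrite TYent_comp (bigD1 k') //= gE eqxx mul1r big1 ?addr0 // => j.
by rewrite gE => /negPf->; rewrite !mul0r.
Qed.

Lemma TYcomp1m X Y (f : hom X Y) : TYcomp (TYid R Y) f = f.
Proof.
apply: TYhom_ext => j i; rewrite (@TYent_compl _ _ _ _ _ _ j _ 1) ?mul1r //.
by move=> k; rewrite TYent_id mulr1 eq_sym.
Qed.

Lemma TYcompm1 X Y (f : hom X Y) : TYcomp f (TYid R X) = f.
Proof.
apply: TYhom_ext => j i; rewrite (@TYent_compr _ _ _ _ _ _ _ i 1) ?mulr1 //.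
by move=> k; rewrite TYent_id mulr1.
Qed.

Lemma TYpinvE X Y (f : hom X Y) (g : hom Y X) :
  TYcomp g f = TYid R X -> TYcomp f g = TYid R Y ->
  pinv (f : phom (X : pobj TY) Y) = g.
Proof.
move=> gf fg; apply: xget_unique; first by split.
move=> h [/= hf fh]; rewrite -[h]TYcomp1m.
by rewrite -[X in TYcomp X h]gf -TYcompA [TYcomp f h]fh TYcompm1.
Qed.

(** The inverse of a morphism that maps the summands of [X] bijectively to those
    of [Y], up to a common scalar. *)
Lemma TYpinv_relabel X Y (f : hom X Y) (s : TYidx X -> TYidx Y) s' c :
    c != 0 -> cancel s s' -> cancel s' s ->
    (forall j i, TYent f j i = (j == s i)%:R * c) ->
  forall i j,
    TYent (pinv (f : phom (X : pobj TY) Y)) i j = (i == s' j)%:R * c^-1.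
Proof.
move=> c0 sK s'K fE.
(* The entry [c] of [f] from [s' j] to [j] is nonzero, so the labels agree. *)
have lab_s' j : TYlab (s' j) = TYlab j.
  apply/eqP; rewrite eq_sym; apply: contraT => /TYent_neq => /(_ f).
  by rewrite fE s'K eqxx mul1r => /eqP; rewrite (negPf c0).
pose g : hom Y X := TYmk (fun i j => (i == s' j)%:R * c^-1).
have gE i j : TYent g i j = (i == s' j)%:R * c^-1.
  rewrite TYent_mk; case: eqP => // ne.
  case: eqP => [eq_i|]; last by rewrite mul0r.
  by case: ne; rewrite eq_i lab_s'.
rewrite (@TYpinvE _ _ f g) //.
  apply: TYhom_ext => i' i; rewrite (@TYent_compr _ _ _ _ _ _ _ (s i) c) //.
  by rewrite gE sK -mulrA mulVf // mulr1 TYent_id.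
apply: TYhom_ext => j' j; rewrite (@TYent_compr _ _ _ _ _ _ _ (s' j) c^-1) //.
by rewrite fE s'K -mulrA mulfV // mulr1 TYent_id.
Qed.

End MatrixCalculus.

(** * Bicharacters *)

Section Bicharacter.
Variables (gT : finGroupType) (K : fieldType) (chi : gT -> gT -> K).
Hypothesis chi_bichar : bicharacter chi.

Lemma bichar_neq0 a b : chi a b != 0.
Proof. by case: chi_bichar. Qed.

Lemma bicharMl a b c : chi (a * b)%g c = chi a c * chi b c.
Proof. by case: chi_bichar. Qed.

Lemma bicharMr a b c : chi a (b * c)%g = chi a b * chi a c.
Proof. by case: chi_bichar. Qed.

Lemma bichar1l a : chi 1%g a = 1.
Proof.
by apply: (mulfI (bichar_neq0 1 a)); rewrite -bicharMl mulg1 mulr1.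
Qed.

Lemma bichar1r a : chi a 1%g = 1.
Proof.
by apply: (mulfI (bichar_neq0 a 1)); rewrite -bicharMr mulg1 mulr1.
Qed.

Lemma bicharVr a b : chi a b^-1%g = (chi a b)^-1.
Proof.
apply: (mulfI (bichar_neq0 a b)).
by rewrite -bicharMr mulgV bichar1r mulfV ?bichar_neq0.
Qed.

Lemma bichar_prodl (I : finType) (a : I -> gT) b :
  chi (\prod_i a i)%g b = \prod_i chi (a i) b.
Proof.
exact: (big_morph (chi^~ b) (fun x y => bicharMl x y b) (bichar1l b)).
Qed.

Lemma bichar_sum : nondegenerate_bichar chi ->
  forall a, \sum_x chi x a = (a == 1%g)%:R * #|gT|%:R.
Proof.
move=> chi_nondeg a; case: eqVneq => [->|a1].
  under eq_bigr => x _ do rewrite bichar1r.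
  by rewrite mul1r sumr_const.
rewrite mul0r; have [x0 x0P] : exists x0, chi x0 a != 1.
  apply/existsP; rewrite -negb_forall; apply: contra a1 => /forallP chi1.
  by apply/eqP/chi_nondeg => x; apply/eqP.
(* Translation by [x0] multiplies the sum by [chi x0 a], which is not 1. *)
apply/eqP; rewrite -[_ == 0](orFb) -(negPf x0P) -subr_eq0 -mulf_eq0.
rewrite mulrBl mul1r subr_eq0; apply/eqP.
rewrite [RHS](reindex_inj (mulgI x0)) mulr_sumr.
by apply: eq_bigr => x _; rewrite bicharMl.
Qed.

End Bicharacter.

(** * Summands of tensor products *)

Section Summands.
Variable gT : finGroupType.
Implicit Types X Y Z W : TYobj gT.

Lemma TYtens_idx_inj X Y (p q : TYidx (TYtens X Y)) :
  (val p).1.1 = (val q).1.1 -> (val p).1.2 = (val q).1.2 ->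
  (val p).2 = (val q).2 -> p = q.
Proof.
case: p q => [[[i j] u] p] [[[i' j'] u'] q] /= eq_i eq_j eq_u.
by apply: val_inj; rewrite /= eq_i eq_j eq_u.
Qed.

(** The summand of [X * Y] equal to [u] in the product of the [i]-th summand of
    [X] and the [j]-th summand of [Y]. *)
Definition TYidx_tens X Y (i : TYidx X) (j : TYidx Y) (u : TYsimple gT)
    (h : TYfus (TYlab i) (TYlab j) u) : TYidx (TYtens X Y) :=
  exist _ (i, j, u) h.

Lemma sum_TYtens (V : zmodType) X Y
    (F : TYidx (TYtens X Y) -> V)
    (G : TYidx X -> TYidx Y -> TYsimple gT -> V) :
  (forall q, F q = G (val q).1.1 (val q).1.2 (val q).2) ->
  \sum_q F q = \sum_i \sum_j \sum_(u | TYfus (TYlab i) (TYlab j) u) G i j u.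
Proof.
move=> FG; rewrite (eq_bigr _ (fun q _ => FG q)).
pose A := [pred q : TYidx X * TYidx Y * TYsimple gT |
  TYfus (TYlab q.1.1) (TYlab q.1.2) q.2].
rewrite -(big_sub A (fun q => G q.1.1 q.1.2 q.2)).
rewrite pair_bigA pair_big_dep /=.
by apply: eq_big => [[[i j] u]|].
Qed.

Lemma big_unit (V : nmodType) (F : unit -> V) : \sum_x F x = F tt.
Proof. by rewrite (big_only1 tt) // => - []. Qed.

Lemma sum_isSome (V : nmodType) (T : finType) (P : pred (option T))
    (F : option T -> V) : P =1 isSome -> \sum_(u | P u) F u = \sum_x F (Some x).
Proof.
move=> PE; rewrite (reindex_omap Some id) => [|[x|]]; rewrite ?PE //.
by apply: eq_bigl => x; rewrite PE eqxx.
Qed.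

End Summands.

(** * The inverse of the associator of [m], [m] and a sum of copies of [m] *)

Section Associator.
Variables (R : realType) (gT : finGroupType).
Variables (chi : gT -> gT -> R[i]) (tau : R).
Implicit Types X Y Z W : TYobj gT.
Local Notation TY := (TY chi tau).
Local Notation m := (TYsimp (None : TYsimple gT)).

Lemma TYent_assoc X Y Z q p :
  TYent (TYassoc chi tau X Y Z) q p =
    [&& (val q).1.1 == (val (val p).1.1).1.1,
        (val (val q).1.2).1.1 == (val (val p).1.1).1.2,
        (val (val q).1.2).1.2 == (val p).1.2 & (val q).2 == (val p).2]%:R *
    TYassoc_coef chi tau
      (TYlab (val (val p).1.1).1.1) (TYlab (val (val p).1.1).1.2)
      (TYlab (val p).1.2) (val p).2 (val (val p).1.1).2 (val (val q).1.2).2.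
Proof.
rewrite TYent_mk.
case: p q => [[[[[[i j] u] p1] k] v] p2] [[[i' [[[j' k'] w] q1]] v'] q2] /=.
by case: (v' == v); rewrite ?andbF ?mul0r ?andbT.
Qed.

Hypothesis chi_bichar : bicharacter chi.
Hypothesis chi_sym : symmetric_bichar chi.
Hypothesis chi_nondeg : nondegenerate_bichar chi.
Hypothesis tau2 : tau ^+ 2 = (#|gT|%:R)^-1.

Lemma tauC2 : tau%:C * tau%:C * #|gT|%:R = 1 :> R[i].
Proof.
have n0 : #|gT|%:R != 0 :> R.
  by rewrite pnatr_eq0 -lt0n; apply/card_gt0P; exists 1%g.
rewrite -(rmorph_nat (@real_complex R)) -!rmorphM /= -expr2 tau2 mulVf //.
Qed.

Lemma bichar_ortho x y :
  \sum_z (tau%:C * chi x z) * (tau%:C * (chi y z)^-1) = (x == y)%:R.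
Proof.
transitivity (tau%:C * tau%:C * \sum_z chi z (x * y^-1)%g).
  rewrite mulr_sumr; apply: eq_bigr => z _.
  by rewrite bicharMr // bicharVr // ![chi z _]chi_sym mulrACA.
rewrite bichar_sum // mulrCA tauC2 mulr1; congr (_%:R).
by rewrite -(inj_eq (mulIg y)) mulgKV mul1g.
Qed.

Section TwoOuterFactors.
Variable W : TYobj gT.
Hypothesis labW : forall k, TYlab (t := W) k = None.

Local Notation MM_W := (TYtens (TYtens m m) W).
Local Notation M_MW := (TYtens m (TYtens m W)).

(** When all summands of [W] are [m], a summand of [(m * m) * W] or of
    [m * (m * W)] is determined by a summand of [W] and by an element of [A],
    namely the intermediate summand of [m * m] or of [m * W]. The intermediate
    summand is never [m], so the default value 1 does not occur. *)
Definition MM_W_elt (p : TYidx MM_W) : gT := odflt 1%g (val (val p).1.1).2.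
Definition M_MW_elt (q : TYidx M_MW) : gT := odflt 1%g (val (val q).1.2).2.

Lemma MM_W_eltP p :
  (val (val p).1.1).2 = Some (MM_W_elt p) /\ (val p).2 = None.
Proof.
case: p => [[[[[[[] []] [u|//]] p1] k] v] p2] /=; split=> //.
by move: p2; rewrite /= labW; case: v.
Qed.

Lemma M_MW_eltP q :
  (val (val q).1.2).2 = Some (M_MW_elt q) /\ (val q).2 = None.
Proof.
case: q => [[[[] [[[[] k] w] q1]] v] q2]; rewrite /M_MW_elt /=.
by move: q1 q2; rewrite /= labW; case: w v => [w|//] [].
Qed.

Lemma MM_W_eq p p' :
  (p == p') = (MM_W_elt p == MM_W_elt p') && ((val p).1.2 == (val p').1.2).
Proof.
apply/eqP/andP => [-> //|[/eqP eq_x /eqP eq_k]].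
have [u v] := MM_W_eltP p; have [u' v'] := MM_W_eltP p'.
apply: TYtens_idx_inj => //; last by rewrite v v'.
apply: TYtens_idx_inj; last by rewrite u u' eq_x.
  by case: (val (val p).1.1).1.1 (val (val p').1.1).1.1 => [] [].
by case: (val (val p).1.1).1.2 (val (val p').1.1).1.2 => [] [].
Qed.

Lemma M_MW_eq q q' :
  (q == q') = (M_MW_elt q == M_MW_elt q') &&
    ((val (val q).1.2).1.2 == (val (val q').1.2).1.2).
Proof.
apply/eqP/andP => [-> //|[/eqP eq_x /eqP eq_k]].
have [u v] := M_MW_eltP q; have [u' v'] := M_MW_eltP q'.
apply: TYtens_idx_inj; last by rewrite v v'.
  by case: (val q).1.1 (val q').1.1 => [] [].
apply: TYtens_idx_inj => //; last by rewrite u u' eq_x.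
by case: (val (val q).1.2).1.1 (val (val q').1.2).1.1 => [] [].
Qed.

Lemma sum_MM_W (V : zmodType) (F : TYidx MM_W -> V) (G : gT -> TYidx W -> V) :
  (forall p, F p = G (MM_W_elt p) (val p).1.2) ->
  \sum_p F p = \sum_k \sum_x G x k.
Proof.
move=> FG.
rewrite (sum_TYtens (G := fun (i : TYidx (TYtens m m)) k _ =>
  G (odflt 1%g (val i).2) k)) //.
rewrite exchange_big; apply: eq_bigr => k _.
rewrite (sum_TYtens (G := fun _ _ u =>
  \sum_(v | TYfus u (TYlab k) v) G (odflt 1%g u) k)) //.
rewrite 2!big_unit.
rewrite sum_isSome => [|[]//]; apply: eq_bigr => x _.
by rewrite labW (big_only1 None) // => -[].
Qed.

Lemma sum_M_MW (V : zmodType) (F : TYidx M_MW -> V) (G : gT -> TYidx W -> V) :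
  (forall q, F q = G (M_MW_elt q) (val (val q).1.2).1.2) ->
  \sum_q F q = \sum_k \sum_x G x k.
Proof.
move=> FG.
rewrite (sum_TYtens (G := fun _ (t : TYidx (TYtens m W)) _ =>
  G (odflt 1%g (val t).2) (val t).1.2)) //.
rewrite big_unit.
rewrite (sum_TYtens (G := fun _ k w =>
  \sum_(v | TYfus (gT := gT) None w v) G (odflt 1%g w) k)) //.
rewrite big_unit; apply: eq_bigr => k _.
rewrite labW sum_isSome => [|[]//]; apply: eq_bigr => x _.
by rewrite (big_only1 None) // => -[].
Qed.

Lemma TYent_assoc_mm q p :
  TYent (TYassoc chi tau m m W) q p =
    ((val (val q).1.2).1.2 == (val p).1.2)%:R *
    (tau%:C * (chi (MM_W_elt p) (M_MW_elt q))^-1).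
Proof.
have [u v] := MM_W_eltP p; have [w v'] := M_MW_eltP q.
rewrite TYent_assoc u v w v' eqxx andbT /= labW.
case: (val q).1.1 (val (val p).1.1).1.1 => [] [].
by case: (val (val q).1.2).1.1 (val (val p).1.1).1.2 => [] [].
Qed.

(** The inverse associator, with entries [tau * chi (x, y)] where the associator
    has [tau / chi (x, y)]. *)
Definition TYassoc_mm_inv : TYhom R M_MW MM_W :=
  TYmk (fun (p : TYidx MM_W) (q : TYidx M_MW) =>
    ((val (val q).1.2).1.2 == (val p).1.2)%:R *
    (tau%:C * chi (MM_W_elt p) (M_MW_elt q))).

Lemma TYent_assoc_mm_inv p q :
  TYent TYassoc_mm_inv p q = ((val (val q).1.2).1.2 == (val p).1.2)%:R *
    (tau%:C * chi (MM_W_elt p) (M_MW_elt q)).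
Proof.
by rewrite TYent_mk /= (proj2 (MM_W_eltP p)) (proj2 (M_MW_eltP q)).
Qed.

Lemma pinv_assoc_mm :
  pinv (TYassoc chi tau m m W : phom (MM_W : pobj TY) M_MW) =
  TYassoc_mm_inv.
Proof.
apply: TYpinvE; apply: TYhom_ext.
  move=> p' p; rewrite TYent_comp TYent_id.
  rewrite (sum_M_MW (G := fun z k =>
    (k == (val p').1.2)%:R * (k == (val p).1.2)%:R *
    ((tau%:C * chi (MM_W_elt p') z) * (tau%:C * (chi (MM_W_elt p) z)^-1))));
    last first.
    by move=> q; rewrite TYent_assoc_mm TYent_assoc_mm_inv mulrACA.
  under eq_bigr => k _ do rewrite -mulr_sumr bichar_ortho.
  rewrite -mulr_suml (big_only1 (val p').1.2) // => [|k /negPf->]; last first.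
    by rewrite mul0r.
  by rewrite eqxx mul1r MM_W_eq mulrC -natrM mulnb.
move=> q' q; rewrite TYent_comp TYent_id.
rewrite (sum_MM_W (G := fun z k =>
  ((val (val q').1.2).1.2 == k)%:R * ((val (val q).1.2).1.2 == k)%:R *
  ((tau%:C * chi (M_MW_elt q) z) * (tau%:C * (chi (M_MW_elt q') z)^-1))));
  last first.
  move=> p; rewrite TYent_assoc_mm TYent_assoc_mm_inv mulrACA.
  rewrite [chi _ (M_MW_elt q)]chi_sym [chi _ (M_MW_elt q')]chi_sym.
  by rewrite [(_ * _^-1) * _]mulrC.
under eq_bigr => k _ do rewrite -mulr_sumr bichar_ortho.
rewrite -mulr_suml (big_only1 (val (val q').1.2).1.2) //.
  rewrite eqxx mul1r M_MW_eq mulrC -natrM mulnb.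
  by rewrite [M_MW_elt _ == _]eq_sym [X in _ && X]eq_sym.
by move=> k kP _; rewrite eq_sym (negPf kP) mul0r.
Qed.

End TwoOuterFactors.

End Associator.

(** * Duality for [m] *)

Section Duality.
Variables (R : realType) (gT : finGroupType).
Variables (chi : gT -> gT -> R[i]) (tau : R).
Hypothesis chi_bichar : bicharacter chi.
Hypothesis chi_sym : symmetric_bichar chi.
Hypothesis chi_nondeg : nondegenerate_bichar chi.
Hypothesis tau2 : tau ^+ 2 = (#|gT|%:R)^-1.
Implicit Types X Y Z W : TYobj gT.
Local Notation TY := (TY chi tau).
Local Notation m := (TYm chi tau).
Local Notation one := (@TYunit gT).

Lemma tauC_neq0 : tau%:C != 0 :> R[i].
Proof.
apply/eqP => tau0; have /eqP := tauC2 tau2.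
by rewrite tau0 !mul0r eq_sym oner_eq0.
Qed.

Lemma TYent_pinv_runit_one (i : TYidx (TYtens one one)) :
  TYent (pinv (prunit (punit : pobj TY))) i tt = 1.
Proof.
pose o : TYidx (TYtens one one) :=
  @TYidx_tens gT one one tt tt (Some (1 * 1)%g) (eqxx _).
have io i' : i' = o.
  by case: i' => [[[[] []] [u|//]] p]; apply: val_inj => /=; move/eqP: p => ->.
rewrite (@TYpinv_relabel _ _ chi tau (TYtens one one) one _
  (fun=> tt) (fun=> o) 1) ?oner_eq0 //.
- by rewrite (io i) eqxx mul1r invr1.
- by case.
by case=> i'; rewrite mulr1 TYent_mk (io i') /= mulg1 eqxx; case: (val o).1.1.
Qed.

Lemma TYent_pinv_runit_m (i : TYidx (TYtens m one)) :
  TYent (pinv (prunit (m : pobj TY))) i tt = 1.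
Proof.
pose o : TYidx (TYtens m one) := @TYidx_tens gT m one tt tt None isT.
have io i' : i' = o.
  by case: i' => [[[[] []] [//|]] p]; apply: val_inj.
rewrite (@TYpinv_relabel _ _ chi tau (TYtens m one) m _
  (fun=> tt) (fun=> o) 1) ?oner_eq0 //.
- by rewrite (io i) eqxx mul1r invr1.
- by case.
by case=> i'; rewrite mulr1 TYent_mk (io i').
Qed.

Lemma TYent_pinv_assoc_1mm p q :
  TYent (pinv (passoc (punit : pobj TY) m m)) p q = ((val p).2 == (val q).2)%:R.
Proof.
have fus1 x : @TYfus gT (TYlab (tt : TYidx one)) (Some x) (Some x).
  by rewrite /= mul1g.
pose L := TYtens (TYtens one m) m; pose M := TYtens one (TYtens m m).
pose s (r : TYidx L) : TYidx M :=
  let x := odflt 1%g (val r).2 in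
  @TYidx_tens gT one (TYtens m m) tt
    (@TYidx_tens gT m m tt tt (Some x) isT) (Some x) (fus1 x).
pose s' (r : TYidx M) : TYidx L :=
  let x := odflt 1%g (val r).2 in
  @TYidx_tens gT (TYtens one m) m
    (@TYidx_tens gT one m tt tt None isT) tt (Some x) isT.
have s2 r : (val (s r)).2 = (val r).2.
  by case: r => [[[[[[[] []] [//|]] r] []] [u|//]] r'].
have s'2 r : (val (s' r)).2 = (val r).2.
  by case: r => [[[[] [[[[] []] [w|//]] r]] [v|//]] r'].
(* On either side, all summands are distinct simple objects. *)
have inj1 (r r' : TYidx L) : (val r).2 = (val r').2 -> r = r'.
  move=> eq2; apply: TYtens_idx_inj => //; last first.
    by case: (val r).1.2 (val r').1.2 => [] [].
  have io i : i = @TYidx_tens gT one m tt tt None isT.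
    by case: i => [[[[] []] [//|]] i]; apply: val_inj.
  by rewrite (io (val r).1.1) (io (val r').1.1).
have inj2 (r r' : TYidx M) : (val r).2 = (val r').2 -> r = r'.
  move=> eq2; apply: TYtens_idx_inj => //.
    by case: (val r).1.1 (val r').1.1 => [] [].
  have sub2 (t : TYidx M) : (val (val t).1.2).2 = (val t).2.
    case: t => [[[[] [[[[] []] [w|//]] t]] [v|//]] t'] /=.
    by have /eqP-> := t'; rewrite mul1g.
  apply: TYtens_idx_inj; last by rewrite !sub2.
    by case: (val (val r).1.2).1.1 (val (val r').1.2).1.1 => [] [].
  by case: (val (val r).1.2).1.2 (val (val r').1.2).1.2 => [] [].
have sK : cancel s s' by move=> r; apply: inj1; rewrite s'2 s2.
have s'K : cancel s' s by move=> r; apply: inj2; rewrite s2 s'2.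
have assocE j i :
    TYent (TYassoc chi tau one m m) j i = (j == s i)%:R * 1.
  rewrite mulr1 TYent_assoc.
  case: (val j).1.1 (val (val i).1.1).1.1 => [] [].
  case: (val (val j).1.2).1.1 (val (val i).1.1).1.2 => [] [].
  case: (val (val j).1.2).1.2 (val i).1.2 => [] [].
  rewrite [TYassoc_coef _ _ _ _ _ _ _ _]/= mulr1 !eqxx.
  congr (nat_of_bool _)%:R.
  by apply/eqP/eqP => [eq2|->]; [apply: inj2; rewrite s2 | rewrite s2].
rewrite (TYpinv_relabel chi tau (oner_neq0 _) sK s'K assocE) invr1 mulr1.
congr (nat_of_bool _)%:R.
by apply/eqP/eqP => [->|eq2]; [rewrite s'2 | apply: inj1; rewrite s'2].
Qed.

Lemma TYent_pinv_piv (i j : TYidx m) :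
  TYent (pinv (ppiv (m : pobj TY))) i j = (Num.sg tau)%:C.
Proof.
have sg2 : (Num.sg tau)%:C * (Num.sg tau)%:C = 1 :> R[i].
  rewrite -rmorphM -expr2 sqr_sg; case: eqP => // tau0.
  by move: tauC_neq0; rewrite tau0 eqxx.
have sg0 : (Num.sg tau)%:C != 0 :> R[i].
  by apply/eqP => sg0; move/eqP: sg2; rewrite sg0 mul0r eq_sym oner_eq0.
rewrite (@TYpinv_relabel _ _ chi tau m m _ id id (Num.sg tau)%:C) //.
  case: i j => [] []; rewrite eqxx mul1r.
  by apply: (mulfI sg0); rewrite mulfV.
by move=> [] []; rewrite TYent_mk.
Qed.

Section SumsOfM.
Variable W : TYobj gT.
Hypothesis labW : forall k, TYlab (t := W) k = None.

Lemma MW_lab (t : TYidx (TYtens m W)) : exists w, (val t).2 = Some w.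
Proof.
by case: t => [[[[] k] [w|] t]] /=; [exists w | move: t; rewrite /= labW].
Qed.

(** Via the duality isomorphism, the [j]-th entry is the entry of [f] at the
    summand 1 of [m * m], where [m] is the [j]-th summand of [W]. *)
Lemma TYent_dualA (f : TYhom R one (TYtens m W)) j p :
  TYent (dualA (f : phom (one : pobj TY) (ptens m W))) j p =
  \sum_t ((val t).1.2 == j)%:R * TYent f t tt.
Proof.
(* The evaluation is nonzero only on the summand 1 of [m * m]. *)
pose h := TYcomp (TYlunit R W) (TYtensh (TYev tau m) (TYid R W)).
have hE r : TYent h j r =
    ((MM_W_elt r == 1%g) && (j == (val r).1.2))%:R * (tau%:C)^-1.
  have lab_j : TYfus (TYlab (tt : TYidx one)) (TYlab j) None by rewrite labW.
  rewrite (@TYent_compl _ _ _ _ _ _ _ _ (TYidx_tens lab_j) _ 1); last first.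
    move=> s; rewrite mulr1 TYent_mk.
    have -> : (s == TYidx_tens lab_j) = (j == (val s).1.2).
      apply/eqP/eqP => [-> //|eq_j]; apply: TYtens_idx_inj => //=.
        by case: (val s).1.1.
      case: s eq_j => [[[[] j'] u] s] /=; rewrite labW in s *.
      by case: u s.
    by rewrite labW; case: s => [[[[] j'] u] /=]; rewrite labW; case: u.
  rewrite mul1r TYent_tensh TYent_id /= (proj2 (MM_W_eltP labW r)) mul1r.
  rewrite TYent_mk /= (proj1 (MM_W_eltP labW r)).
  case: (val (val r).1.1).1.1 (val (val r).1.1).1.2 => [] [].
  have [->|ne] := eqVneq (MM_W_elt r) 1%g; first by rewrite eqxx mul1r mulrC.
  case: eqP => [[x1]|_]; first by rewrite -x1 eqxx in ne.
  by rewrite !mul0r.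
rewrite /dualA /= pinv_assoc_mm // -/h.
rewrite TYent_comp (sum_TYtens (G := fun i (t : TYidx (TYtens m W)) v =>
  ((val t).1.2 == j)%:R * TYent f t tt)) /=.
  rewrite big_unit; apply: eq_bigr => t _.
  by have [w ->] := MW_lab t; rewrite (big_only1 None) // => -[].
move=> q; rewrite TYent_tensh; congr (_ * _).
  rewrite TYent_comp.
  rewrite (sum_MM_W labW (G := fun x k => ((x == 1%g) && (j == k))%:R / tau%:C *
     (((val (val q).1.2).1.2 == k)%:R * (tau%:C * chi x (M_MW_elt q))))) //.
    rewrite (big_only1 j) //.
      rewrite (big_only1 1%g) //; last by move=> x /negPf->; rewrite !mul0r.
      (* The inverse associator has the entry [tau * chi 1 _ = tau]. *)
      rewrite (bichar1l chi_bichar) !eqxx mulr1 mul1r mulrCA.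
      by rewrite mulVf ?mulr1 // tauC_neq0.
    move=> k kj _; rewrite big1 // => x _.
    by rewrite [j == k]eq_sym (negPf kj) andbF !mul0r.
  by move=> r; rewrite hE TYent_assoc_mm_inv.
rewrite (proj2 (M_MW_eltP labW q)).
case: p => [[[[] []] u] /=]; case: u => // _; case: (val q).1.1.
by rewrite TYent_id mul1r mul1r.
Qed.

(** The unit only maps to the summands of [W * m] equal to the unit. *)
Lemma TYent_dualB (g : TYhom R (TYtens one m) W) s :
  TYent (dualB (g : phom (ptens (punit : pobj TY) m) (W : pobj TY))) s tt =
  ((val s).2 == Some 1%g)%:R *
    TYent g (val s).1.1 (@TYidx_tens gT one m tt tt None isT).
Proof.
(* The unit is carried to the summand [o] of [1 * 1], then to [e] by the
   coevaluation and to [e'] by the inverse associator. *)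
pose fus1 : @TYfus gT (TYlab (tt : TYidx one)) (Some 1%g) (Some (1 * 1)%g) :=
  eqxx _.
pose o : TYidx (TYtens one one) :=
  @TYidx_tens gT one one tt tt (Some (1 * 1)%g) fus1.
pose e : TYidx (TYtens one (TYtens m m)) :=
  @TYidx_tens gT one (TYtens m m) tt (@TYidx_tens gT m m tt tt (Some 1%g) isT)
    (Some (1 * 1)%g) fus1.
pose e' : TYidx (TYtens (TYtens one m) m) :=
  @TYidx_tens gT (TYtens one m) m
    (@TYidx_tens gT one m tt tt None isT) tt (Some 1%g) isT.
have oE i : i = o.
  by case: i => [[[[] []] [u|//]] p]; apply: val_inj => /=; move/eqP: p => ->.
rewrite /dualB /= (@TYent_compr _ _ _ _ _ _ _ _ _ o 1); last first.
  by move=> i; rewrite (TYent_pinv_runit_one i) (oE i) eqxx mulr1.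
rewrite mulr1 (@TYent_compr _ _ _ _ _ _ _ _ _ e 1); last first.
  move=> q; rewrite mulr1 TYent_tensh TYent_id /=.
  have -> : (q == e) =
      ((val q).2 == Some (1 * 1)%g) && ((val (val q).1.2).2 == Some 1%g).
    apply/eqP/andP => [-> //|[/eqP eq2 /eqP eqw]].
    apply: (@TYtens_idx_inj gT one (TYtens m m) q e) => //.
      by case: (val q).1.1.
    apply: (@TYtens_idx_inj gT m m (val q).1.2 (val e).1.2) => //.
      by case: (val (val q).1.2).1.1.
    by case: (val (val q).1.2).1.2.
  case: (val q).1.1; rewrite mulr1 TYent_mk /=.
  case: (val (val q).1.2).1.1 (val (val q).1.2).1.2 => [] [].
  by do 2!case: (_ == _); rewrite ?mulr1 ?mul0r ?mulr0.
rewrite mulr1 (@TYent_compr _ _ _ _ _ _ _ _ _ e' 1); last first.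
  move=> q; rewrite mulr1 TYent_pinv_assoc_1mm /= mulg1.
  congr (nat_of_bool _)%:R.
  apply/eqP/eqP => [eq2|-> //].
  apply: (@TYtens_idx_inj gT (TYtens one m) m q e') => //.
    have io i : i = @TYidx_tens gT one m tt tt None isT.
      by case: i => [[[[] []] [//|]] i]; apply: val_inj.
    by rewrite [LHS]io.
  by case: (val q).1.2.
by rewrite mulr1 TYent_tensh TYent_id /=; case: (val s).1.2; rewrite mulr1.
Qed.

End SumsOfM.

End Duality.

(** * Indicators via a recursion on tensor powers *)

Section PowerInduction.
Variables (K : fieldType) (C : pivotalData K) (V : pobj C).

(** The map [E_V^(n)], with [X] standing for [V^(n-1)] and [phi] for the
    associativity isomorphism from [V^(n-1) * V] to [V^n = V * V^(n-1)]. *)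
Definition FSrot_via (X : pobj C) (phi : phom (ptens X V) (ptens V X))
    (f : phom punit (ptens V X)) : phom punit (ptens V X) :=
  Defs.pcomp (Defs.pcomp phi (ptensh (pid X) (pinv (ppiv V))))
    (dualB (Defs.pcomp (Defs.pcomp (dualA (Defs.pcomp (pid (ptens V X)) f))
       (pinv (prunit (pdual V)))) (plunit (pdual V)))).

Lemma FSrot_via_linear X phi : linear (@FSrot_via X phi).
Proof.
move=> a f g; rewrite /FSrot_via /dualB /dualA.
by rewrite !(pcomp_linearr, pcomp_linearl, ptensh_linearr, ptensh_linearl).
Qed.

(** A property that propagates along the recursive construction of the
    associativity isomorphisms [V^(p+1) * V -> V^(p+2)] holds of some [phi] that
    computes the indicators. Over an abstract category the recursion equation
    of the tensor powers holds by computation; the existential statement spares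
    unfolding them in the Tambara-Yamagami category. *)
Lemma FSind_tpow_ind
    (P : nat -> forall X, phom (ptens X V) (ptens V X) -> Prop) :
    P 0 V (pid _) ->
    (forall p X phi, P p X phi ->
       P p.+1 (ptens V X) (Defs.pcomp (ptensh (pid V) phi) (passoc V X V))) ->
  forall p, exists (X : pobj C) (phi : phom (ptens X V) (ptens V X)),
    P p X phi /\ FSind V p.+2 = lftrace (linfun (@FSrot_via X phi)).
Proof.
move=> P0 PS p; exists (tpow V p.+1), (tpow_assoc V p.+1); split=> //.
by elim: p => [//|p IHp]; exact: PS IHp.
Qed.

End PowerInduction.

(** * Sums over tuples with a given product *)

Section TupleSum.
Variables (gT : finGroupType) (K : fieldType) (chi : gT -> gT -> K).
Hypothesis chi_bichar : bicharacter chi.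

(** The sum, over the [k]-tuples with product [v], of the products of the
    [chi (a i) (a j)] for [i < j]. *)
Definition bichar_tuple_sum k v : K :=
  \sum_(a : {ffun 'I_k -> gT} | (\prod_(i < k) a i)%g == v)
      \prod_(i < k) \prod_(j < k | (i < j)%N) chi (a i) (a j).

(** The tuple [p.1] extended by the last entry [p.2]. *)
Definition ffun_rcons (T : Type) k (p : {ffun 'I_k -> T} * T) :
    {ffun 'I_k.+1 -> T} :=
  [ffun i => if unlift ord_max i is Some j then p.1 j else p.2].

Lemma ffun_rcons_widen T k (p : {ffun 'I_k -> T} * T) i :
  ffun_rcons p (widen_ord (leqnSn k) i) = p.1 i.
Proof.
rewrite ffunE; have -> : widen_ord (leqnSn k) i = lift ord_max i.
  by apply: val_inj; rewrite /= /bump leqNgt ltn_ord.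
by rewrite liftK.
Qed.

Lemma ffun_rcons_max T k (p : {ffun 'I_k -> T} * T) :
  ffun_rcons p ord_max = p.2.
Proof. by rewrite ffunE unlift_none. Qed.

Lemma ffun_rcons_bij T k : bijective (@ffun_rcons T k).
Proof.
exists (fun a : {ffun 'I_k.+1 -> T} =>
  ([ffun i => a (lift ord_max i)], a ord_max)).
  case=> a x; congr (_, _); last exact: ffun_rcons_max.
  by apply/ffunP => i; rewrite !ffunE liftK.
move=> a; apply/ffunP => i; rewrite ffunE /=.
by case: unliftP => [j|] ->; rewrite ?ffunE.
Qed.

Lemma bichar_tuple_sum1 v : bichar_tuple_sum 1 v = 1.
Proof.
rewrite /bichar_tuple_sum (big_only1 [ffun=> v]); last 2 first.
- by rewrite big_ord1 ffunE.
- move=> a ne; rewrite big_ord1 => /eqP av; case/eqP: ne.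
  by apply/ffunP => i; rewrite ffunE (ord1 i).
by rewrite big_ord1 big_mkcond big_ord1.
Qed.

(** The last entry of a tuple with product [v] is determined by the product [x]
    of the other entries: it is [x^-1 * v]. *)
Lemma bichar_tuple_sumS k v :
  bichar_tuple_sum k.+1 v =
  \sum_x chi x v * (chi x x)^-1 * bichar_tuple_sum k x.
Proof.
rewrite /bichar_tuple_sum (reindex _ (onW_bij _ (@ffun_rcons_bij _ k))).
pose P (a : {ffun 'I_k -> gT}) := (\prod_(i < k) a i)%g.
pose T (a : {ffun 'I_k -> gT}) :=
  \prod_(i < k) \prod_(j < k | (i < j)%N) chi (a i) (a j).
transitivity (\sum_(p : {ffun 'I_k -> gT} * gT | (P p.1 * p.2)%g == v)
    T p.1 * chi (P p.1) p.2).
  apply: eq_big => [p|p _].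
    rewrite big_ord_recr /= ffun_rcons_max; congr ((_ * _)%g == _).
    by apply: eq_bigr => i _; rewrite ffun_rcons_widen.
  (* No index exceeds the last one, which only occurs as [j]. *)
  rewrite big_ord_recr /= [X in _ * X]big1 ?mulr1; last first.
    by move=> j; rewrite ltnNge -ltnS ltn_ord.
  rewrite bichar_prodl // -big_split; apply: eq_bigr => i _ /=.
  rewrite big_mkcond big_ord_recr /= ltn_ord ffun_rcons_max ffun_rcons_widen.
  congr (_ * _); rewrite [RHS]big_mkcond /=.
  by apply: eq_bigr => j _; rewrite ffun_rcons_widen.
rewrite (partition_big (fun p => P p.1) predT) //=; apply: eq_bigr => x _.
rewrite mulr_sumr.
rewrite (reindex_onto (fun a => (a, (x^-1 * v)%g)) (fun p => p.1)); last first.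
  by move=> [a y] /andP[/= /eqP <- /eqP <-]; rewrite mulKg.
apply: eq_big => [a|a /= /andP[/andP[_ /eqP Pa] _]].
  rewrite /= eqxx andbT.
  by case: (eqVneq (P a) x) => [->|]; rewrite ?andbF // mulKVg eqxx.
by rewrite Pa bicharMr // bicharVr // mulrC [_^-1 * _]mulrC.
Qed.

End TupleSum.

(** * The associativity isomorphisms of the powers of [m] *)

Section Powers.
Variables (R : realType) (gT : finGroupType).
Variables (chi : gT -> gT -> R[i]) (tau : R).
Implicit Types X Y Z W : TYobj gT.
Local Notation TY := (TY chi tau).
Local Notation m := (TYm chi tau).
Local Notation one := (@TYunit gT).

Lemma TYfus_m (a w : TYsimple gT) : isSome w = ~~ isSome a -> TYfus a None w.
Proof. by case: a w => [a|] [w|]. Qed.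

(** If the entries of [phi] are given by [c], those of the next associativity
    isomorphism are given by [c] and one associator: in the sum over the middle
    object, only one summand contributes. *)
Lemma TYent_assoc_step X Y (phi : TYhom R (TYtens X m) Y)
    (c : TYidx Y -> TYidx X -> R[i]) :
    (forall j q, TYfus (TYlab (t := X) j) None (TYlab (t := Y) q)) ->
    (forall q s, TYent phi q s = ((val s).2 == TYlab q)%:R * c q (val s).1.1) ->
  forall q s,
    TYent (TYcomp (TYtensh (TYid R m) phi) (TYassoc chi tau m X m)) q s =
    ((val s).2 == (val q).2)%:R *
      (TYassoc_coef chi tau None (TYlab (val (val s).1.1).1.2) None
         (val q).2 (val (val s).1.1).2 (TYlab (val q).1.2) *
       c (val q).1.2 (val (val s).1.1).1.2).
Proof.
move=> fusXY phiE q s.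
pose j := val (val s).1.1.
have fusj : TYfus (TYlab j.1.2) (TYlab (tt : TYidx m)) (TYlab (val q).1.2).
  exact: fusXY.
have fusq : TYfus (TYlab (tt : TYidx m)) (TYlab (val q).1.2) (val q).2.
  by move: (valP q); case: (val q) => [[[] q'] v].
pose t0 : TYidx (TYtens m (TYtens X m)) :=
  @TYidx_tens gT m (TYtens X m) tt (TYidx_tens fusj) (val q).2 fusq.
rewrite TYent_comp (big_only1 t0) // => [|t tt0 _].
  rewrite TYent_tensh TYent_id TYent_assoc phiE [val t0]/=.
  rewrite [val (TYidx_tens fusj)]/= [fst _]/= [snd _]/=.
  case: (val q).1.1 (val (val s).1.1).1.1 (val s).1.2 => [] [] [].
  rewrite !eqxx !mul1r [_ && _]/= [(val s).2 == _]eq_sym.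
  by case: eqVneq => [->|_]; rewrite ?mul0r ?mulr0 // !mul1r mulrC.
rewrite TYent_tensh TYent_id TYent_assoc phiE.
case: (eqVneq (val q).2 (val t).2) => [eq_v|]; last by rewrite !mul0r.
case: (eqVneq (val (val t).1.2).2 (TYlab (val q).1.2)) => [eq_w|]; last first.
  by rewrite !(mul0r, mulr0).
case: (eqVneq (val (val t).1.2).1.1 j.1.2) => [eq_j|]; last first.
  by rewrite !(andbF, mul0r, mulr0).
case/eqP: tt0; apply: TYtens_idx_inj => //; first by case: (val t).1.1.
apply: TYtens_idx_inj => //.
by case: (val (val t).1.2).1.2.
Qed.

Hypothesis chi_bichar : bicharacter chi.
Hypothesis chi_sym : symmetric_bichar chi.
Hypothesis chi_nondeg : nondegenerate_bichar chi.
Hypothesis tau2 : tau ^+ 2 = (#|gT|%:R)^-1.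

Section Rotation.
Variable X : TYobj gT.
Hypothesis labX : forall j, TYlab (t := X) j = None.
Variable phi : TYhom R (TYtens X m) (TYtens m X).
Variable c : TYsimple gT -> TYidx X -> TYidx X -> R[i].
Hypothesis phiE : forall q s,
  TYent phi q s = ((val s).2 == (val q).2)%:R *
    c (val q).2 (val q).1.2 (val s).1.1.

(** The diagonal entry of [E_m^(n)] at the basis vector of the summand [q]. *)
Lemma FSrot_diag (q : TYidx (TYtens m X)) (f : TYhom R one (TYtens m X)) :
    (val q).2 = Some 1%g -> (forall t, TYent f t tt = (t == q)%:R) ->
  TYent (@FSrot_via _ TY m X phi f : TYhom R one (TYtens m X)) q tt =
    (Num.sg tau)%:C * c (Some 1%g) (val q).1.2 (val q).1.2.
Proof.
move=> q2 fE.
pose g := TYcomp (TYcomp (dualA (f : phom (one : pobj TY) (ptens m X)))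
  (pinv (prunit (m : pobj TY)))) (TYlunit R m).
have gE j r : TYent g j r = (j == (val q).1.2)%:R.
  rewrite (@TYent_compr _ _ (TYtens one m) m _ _ _ _ _ tt 1); last first.
    by case; rewrite mulr1 TYent_mk; case: r => [[[[] []] [//|]] r].
  rewrite mulr1 TYent_comp.
  rewrite (big_only1 (@TYidx_tens gT m one tt tt None isT)) //; last first.
    move=> i /eqP ne _; case: ne; case: i => [[[[] []] [//|]] i].
    exact: val_inj.
  rewrite TYent_pinv_runit_m mulr1 TYent_dualA // (big_only1 q) //.
    by rewrite fE eqxx mulr1 eq_sym.
  by move=> t /negPf tq _; rewrite fE tq mulr0.
have fus1 : TYfus (TYlab (val q).1.2) (TYlab (tt : TYidx m)) (Some 1%g).
  by rewrite labX.
(* The only summand of [X * m] reached by the basis vector [f]. *)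
pose s0 : TYidx (TYtens X m) := TYidx_tens fus1.
have s0P s :
    (s == s0) = ((val s).2 == Some 1%g) && ((val s).1.1 == (val q).1.2).
  apply/eqP/andP => [-> //|[/eqP eq2 /eqP eq1]].
  by apply: TYtens_idx_inj => //; case: (val s).1.2.
pose fh : phom (punit : pobj TY) (ptens m X) := f.
have pidf : Defs.pcomp (pid (ptens (m : pobj TY) X)) fh = f by exact: TYcomp1m.
rewrite /FSrot_via -/fh pidf.
rewrite (@TYent_compr _ _ _ _ _ _ _ _ _ s0 1); last first.
  move=> s; rewrite TYent_dualB gE s0P mulr1.
  by case: (_ == _); case: (_ == _); rewrite ?mulr1 ?mulr0.
rewrite mulr1 (@TYent_compr _ _ _ _ _ _ _ _ _ s0 (Num.sg tau)%:C); last first.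
  move=> s; rewrite TYent_tensh TYent_id TYent_pinv_piv // s0P.
  by case: (_ == _); case: (_ == _); rewrite ?mul1r ?mul0r ?mulr0.
by rewrite phiE q2 eqxx mul1r mulrC.
Qed.

(** The Hom-space from the unit to [m * X] has one basis vector for each summand
    of [X], since all of these are equal to [m]. *)
Lemma FSrot_trace :
  lftrace (linfun (@FSrot_via _ TY m X phi)) =
    (Num.sg tau)%:C * \sum_(j : TYidx X) c (Some 1%g) j j.
Proof.
rewrite lftrace_ffun.
pose G (q : TYidx (TYtens m X)) :=
  (Num.sg tau)%:C * c (Some 1%g) (val q).1.2 (val q).1.2.
pose A := [pred pr : TYidx (TYtens m X) * TYidx one | TYlab pr.1 == TYlab pr.2].
transitivity (\sum_(x : {pr | A pr}) G (val x).1).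
  apply: eq_bigr => -[[q []] qP] _.
  rewrite (linfunE_linear (@FSrot_via_linear _ TY m X phi)).
  set f := [ffun _ => _].
  apply: etrans (TYent_val
    (@FSrot_via _ TY m X phi f : TYhom R one (TYtens m X)) _) _.
  rewrite FSrot_diag //; first exact/eqP.
  move=> t; rewrite /TYent; case: insubP => [[[t' []] t'P] _ [<-]|].
    rewrite ffunE; congr (nat_of_bool _)%:R.
    by apply/eqP/eqP => [[]|eq_t] //; apply: val_inj; rewrite /= eq_t.
  by case: (eqVneq t q) => [->|//]; rewrite qP.
rewrite -(big_sub A (fun pr => G pr.1)) big_mkcond.
rewrite -(pair_bigA _ (fun q (u : TYidx one) =>
  if TYlab q == TYlab u then G q else 0)).
rewrite (sum_TYtens (G := fun _ j v => if v == Some 1%g then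
  (Num.sg tau)%:C * c (Some 1%g) j j else 0)).
  rewrite big_unit mulr_sumr; apply: eq_bigr => j _; rewrite labX.
  by rewrite (big_only1 (Some 1%g)) ?eqxx // => v /negPf->.
by move=> q; rewrite big_unit.
Qed.

End Rotation.

(** The invariant of the recursion, for [X] the power [m^(p+1)] and [phi] the
    associativity isomorphism from [X * m] to [m * X]. The parity of [p] decides
    whether the summands of [X] are all [m] or all in [A]. The entries of [phi]
    are given by coefficients [c], where [c v i j] is the entry from the [j]-th
    summand of [X] to the [i]-th, for the summand [v] of both products. The sum
    of the diagonal coefficients is known when [p = 2k]; when [p = 2k + 1] it is
    stated with the factor of the next associator, of type [(m, x, m)], and with
    the exponent [uphalf p = k + 1], as it then is the sum for [p + 1]. *)
Definition assoc_spec (p : nat) X (phi : TYhom R (TYtens X m) (TYtens m X)) :=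
  (forall j, isSome (TYlab (t := X) j) = odd p) /\
  exists c : TYsimple gT -> TYidx X -> TYidx X -> R[i],
    (forall q s, TYent phi q s = ((val s).2 == (val q).2)%:R *
       c (val q).2 (val q).1.2 (val s).1.1) /\
    forall v, \sum_(j : TYidx X)
        (if odd p then
           TYassoc_coef chi tau None (TYlab j) None (Some v) None None *
             c None j j
         else c (Some v) j j) =
      tau%:C ^+ uphalf p * bichar_tuple_sum chi (uphalf p).+1 v.

Lemma assoc_spec0 : @assoc_spec 0 m (TYid R (TYtens m m)).
Proof.
split=> //; exists (fun _ _ _ => 1); split=> [q s|v].
  rewrite TYent_id mulr1; congr (nat_of_bool _)%:R.
  apply/eqP/eqP => [-> //|eq2]; apply: TYtens_idx_inj => //.
    by case: (val q).1.1 (val s).1.1 => [] [].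
  by case: (val q).1.2 (val s).1.2 => [] [].
by rewrite big_unit bichar_tuple_sum1 expr0 mulr1.
Qed.

Lemma assoc_specS p X phi : @assoc_spec p X phi ->
  @assoc_spec p.+1 (TYtens m X)
    (TYcomp (TYtensh (TYid R m) phi) (TYassoc chi tau m X m)).
Proof.
move=> [labX [c [phiE sum_c]]].
have labmX (q : TYidx (TYtens m X)) : isSome (TYlab q) = ~~ odd p.
  rewrite -(labX (val q).1.2).
  by case: q => [[[[] j] u] q] /=; case: (TYlab j) u q => [a|] [].
split=> //.
exists (fun v q j => TYassoc_coef chi tau None (TYlab (val j).1.2) None
    v (val j).2 (val q).2 * c (val q).2 (val q).1.2 (val j).1.2).
split=> [q s|v].
  have fus_X (j : TYidx X) (q' : TYidx (TYtens m X)) :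
      TYfus (TYlab j) None (TYlab q').
    by apply: TYfus_m; rewrite labX labmX.
  exact: (TYent_assoc_step
    (c := fun q' : TYidx (TYtens m X) => c (val q').2 (val q').1.2)
    fus_X phiE q s).
rewrite [odd _]/=.
case: (boolP (odd p)) labX sum_c => [p_odd|p_even] labX sum_c.
  rewrite (sum_TYtens (G := fun _ j u => TYassoc_coef chi tau
    None (TYlab j) None (Some v) u u * c u j j)) // big_unit.
  have -> : uphalf p.+1 = uphalf p by rewrite uphalfE /= uphalf_half p_odd.
  rewrite -sum_c; apply: eq_bigr => j _; have := labX j.
  by case: (TYlab j) => // a _; rewrite (big_only1 None) // => -[].
rewrite (sum_TYtens (G := fun _ j u => TYassoc_coef chi tau
  None u None (Some v) None None * (TYassoc_coef chi tau
  None (TYlab j) None None u u * c u j j))) // big_unit.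
have -> : uphalf p.+1 = (uphalf p).+1.
  by rewrite uphalfE /= uphalf_half (negPf p_even).
rewrite bichar_tuple_sumS // exprS mulr_sumr.
transitivity (\sum_x \sum_(j : TYidx X)
    chi x v * (tau%:C * (chi x x)^-1 * c (Some x) j j)).
  rewrite exchange_big; apply: eq_bigr => j _; have := labX j.
  by case: (TYlab j) => // _; rewrite sum_isSome // => -[].
apply: eq_bigr => x _; rewrite -!mulr_sumr sum_c !mulrA; congr (_ * _).
by rewrite mulrAC [chi x v * _]mulrC -!mulrA; congr (_ * _); rewrite mulrCA.
Qed.

End Powers.

Theorem theorem3p4 (R : realType) (gT : finGroupType)
    (abA : abelian [set: gT])
    (chi : gT -> gT -> R[i])
    (chi_bichar : bicharacter chi)
    (chi_sym : symmetric_bichar chi)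
    (chi_nondeg : nondegenerate_bichar chi)
    (tau : R) (tau2 : tau ^+ 2 = (#|gT|%:R)^-1)
    (n k : nat) (n_gt0 : (0 < n)%N) (n_even : n = (2 * k)%N) :
  FSind (TYm chi tau) n =
    (Num.sg tau ^+ k / Num.sqrt #|gT|%:R ^+ (k - 1))%:C *
    \sum_(a : {ffun 'I_k -> gT} | (\prod_(i < k) a i)%g == 1%g)
      \prod_(i < k) \prod_(j < k | (i < j)%N) chi (a i) (a j).
Proof.
case: k n_even => [|k] n_even; first by rewrite n_even in n_gt0.
have -> : n = k.*2.+2 by rewrite n_even mul2n doubleS.
have [X [phi [[labX [c [phiE sum_c]]] ->]]] :=
  FSind_tpow_ind (V := TYm chi tau)
    (P := fun p X phi => @assoc_spec _ _ chi tau p X phi)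
    (@assoc_spec0 _ _ chi tau) (@assoc_specS _ _ chi tau chi_bichar) k.*2.
rewrite odd_double in labX sum_c.
rewrite (FSrot_trace chi_bichar chi_sym chi_nondeg tau2 _ phiE); last first.
  by move=> j; have := labX j; case: (TYlab j).
rewrite sum_c uphalf_double mulrA; congr (_ * _).
rewrite subSS subn0 -rmorphXn -rmorphM; congr (_%:C).
(* The remaining scalar is [sgn tau * tau ^ k], with [tau = sgn tau * |tau|]. *)
have sqrtV : (Num.sqrt #|gT|%:R)^-1 = `|tau|.
  by rewrite -sqrtrV ?ler0n // -tau2 sqrtr_sqr.
by rewrite -exprVn sqrtV exprS -mulrA -exprMn -numEsg.
Qed.
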